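(* Let $\Gamma$ be a non-elementary hyperbolic group. For any $d,d_*\in\mathcal{D}_\Gamma$ there exists some $C\ge 0$ such that $$\mathrm{Dil}(d,d_* )^{-1}(x|y)_{o,d}-C\le (x|y)_{o,d_*}\le \mathrm{Dil}(d_*,d)\,(x|y)_{o,d}+C$$ for all $x,y\in\Gamma$.
   Context: $\Gamma$ is a non-elementary (i.e. not virtually cyclic) Gromov hyperbolic group with identity element $o$. A pseudo metric $d$ on $\Gamma$ is a symmetric function $d:\Gamma\times\Gamma\to[0,\infty)$ satisfying the triangle inequality and $d(x,x)=0$. Its Gromov product is $(x|y)_{z,d}=\frac12(d(x,z)+d(z,y)-d(x,y))$. It is hyperbolic if there is $\delta\ge0$ with $(x|y)_{z,d}\ge\min\{(x|w)_{z,d},(w|y)_{z,d}\}-\delta$ for all $x,y,z,w\in\Gamma$. Two pseudo metrics on $\Gamma$ are quasi-isometric if the identity map of $\Gamma$ is a quasi-isometry between them. $\mathcal{D}_\Gamma$ is the set of all left-invariant hyperbolic pseudo metrics on $\Gamma$ that are quasi-isometric to a word metric (for a finite symmetric generating set). For $d\in\mathcal{D}_\Gamma$, the stable translation length is $\ell_d[x]=\lim_{n\to\infty}\frac1n d(o,x^n)$, where $[x]$ is the conjugacy class of $x\in\Gamma$. Let $\mathbf{conj}'$ be the set of conjugacy classes of non-torsion elements of $\Gamma$. For $d,d_*\in\mathcal{D}_\Gamma$ the dilation is $\mathrm{Dil}(d,d_* )=\sup_{[x]\in\mathbf{conj}'}\frac{\ell_d[x]}{\ell_{d_*}[x]}$.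 *)

(* Defs.v *)
From HB Require Import structures.
From mathcomp Require Import all_boot all_order all_algebra.
From mathcomp Require Import boolp classical_sets functions cardinality.
From mathcomp Require Import reals topology normedtype sequences.

Set Implicit Arguments.
Unset Strict Implicit.
Unset Printing Implicit Defensive.

Import Order.TTheory GRing.Theory Num.Theory.
Import numFieldNormedType.Exports.

Local Open Scope classical_set_scope.
Local Open Scope ring_scope.

(** * Pseudo metrics *)

Section PseudoMetrics.
Variables (R : realType) (X Y : Type).

Definition pseudo_metric (d : X -> X -> R) : Prop :=
  [/\ forall x y, 0 <= d x y,
      forall x, d x x = 0,
      forall x y, d x y = d y x
    & forall x y z, d x z <= d x y + d y z].

(* [gromov_product d z x y] is $(x|y)_{z,d}$: the base point comes first. *)
Definition gromov_product (d : X -> X -> R) (z x y : X) : R :=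
  2^-1 * (d x z + d z y - d x y).

Definition gromov_hyperbolic (d : X -> X -> R) : Prop :=
  exists2 delta : R, 0 <= delta &
    forall x y z w,
      Num.min (gromov_product d z x w) (gromov_product d z w y) - delta
        <= gromov_product d z x y.

Definition quasi_isometry (dX : X -> X -> R) (dY : Y -> Y -> R) (f : X -> Y) :
    Prop :=
  exists L A : R,
    [/\ 1 <= L, 0 <= A,
        forall x x', L^-1 * dX x x' - A <= dY (f x) (f x') <= L * dX x x' + A
      & forall y, exists x, dY (f x) y <= A].

End PseudoMetrics.

Definition quasi_isometric (R : realType) (X : Type) (d1 d2 : X -> X -> R) :
    Prop :=
  quasi_isometry d1 d2 id.

(** * Word metrics and hyperbolic groups *)

Section Groups.
Variable G : groupType.

Definition symmetric_set (S : set G) : Prop := forall s, S s -> S (s^-1)%g.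

(* The words over [S] that spell [x]; no formal inverses are needed since [S]
   is always taken symmetric. *)
Definition words (S : set G) (x : G) : set (seq G) :=
  [set w | {in w, forall s, S s} /\ (\prod_(s <- w) s)%g = x].

Definition generating (S : set G) : Prop := forall x, words S x !=set0.

Definition finite_symmetric_generating (S : set G) : Prop :=
  [/\ finite_set S, symmetric_set S & generating S].

(* When [S] generates, this infimum of natural numbers is a minimum. *)
Definition word_length (R : realType) (S : set G) (x : G) : R :=
  inf [set (size w)%:R | w in words S x].

Definition word_metric (R : realType) (S : set G) (x y : G) : R :=
  word_length R S (x^-1 * y)%g.

Definition hyperbolic_group (R : realType) : Prop :=
  exists2 S : set G,
    finite_symmetric_generating S & gromov_hyperbolic (word_metric R S).

Definition cyclic_subgroup (g : G) : set G :=
  [set h | exists n : nat, h = (g ^+ n)%g \/ h = (g ^- n)%g].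

Definition left_coset (H : set G) (x : G) : set G := [set (x * h)%g | h in H].

Definition finite_index (H : set G) : Prop := finite_set (range (left_coset H)).

Definition virtually_cyclic : Prop :=
  exists g : G, finite_index (cyclic_subgroup g).

Definition torsion (x : G) : Prop := exists2 n : nat, (0 < n)%N & (x ^+ n)%g = 1%g.

Definition conj_class (x : G) : set G := range (conjg x).

Definition nontorsion_classes : set (set G) :=
  [set conj_class x | x in [set x | ~ torsion x]].

End Groups.

Definition non_elementary_hyperbolic (R : realType) (G : groupType) : Prop :=
  hyperbolic_group G R /\ ~ virtually_cyclic G.

(** * The space of metrics and the dilation *)

Section Dilation.
Variables (R : realType) (G : groupType).

Definition left_invariant (d : G -> G -> R) : Prop :=
  forall g x y, d (g * x)%g (g * y)%g = d x y.

Definition metrics : set (G -> G -> R) :=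
  [set d | [/\ pseudo_metric d, left_invariant d, gromov_hyperbolic d
    & exists2 S : set G,
        finite_symmetric_generating S & quasi_isometric d (word_metric R S)]].

(* The limit exists (subadditivity) and depends only on the conjugacy class of
   [x] as soon as [d] is a left-invariant pseudo metric. *)
Definition translation_length (d : G -> G -> R) (x : G) : R :=
  limn (fun n : nat => n%:R^-1 * d 1%g (x ^+ n)%g).

(* For [d] and [ds] in [metrics] and [G] non-elementary hyperbolic, the ratios
   have positive denominators and form a nonempty bounded set, so that neither
   the default value of [^-1] at 0 nor that of [sup] comes into play. *)
Definition Dil (d ds : G -> G -> R) : R :=
  sup [set translation_length d x / translation_length ds x
        | x in [set x | nontorsion_classes (conj_class x)]].

End Dilation.

(* Main.v *)
Require Import Defs.
From mathcomp Require Import all_boot all_order all_algebra.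
From mathcomp Require Import boolp classical_sets cardinality.
From mathcomp Require Import reals topology normedtype sequences.
From mathcomp Require Import lra zify.

Set Implicit Arguments.
Unset Strict Implicit.
Unset Printing Implicit Defensive.

Import Order.TTheory GRing.Theory Num.Theory.
Import numFieldNormedType.Exports.

Local Open Scope classical_set_scope.
Local Open Scope ring_scope.

(** Write [l] for [Dil ds d].  The upper bound says that the pseudo metric [ds]
    is at most [l * d] up to a constant, not only for distances but also for
    Gromov products; the lower bound is the upper bound with [d] and [ds]
    exchanged, divided by the positive number [Dil d ds].

    Distances come first.  The stable translation length [tl] satisfies
    [tl_ds <= l * tl_d] by definition of the dilation, and [tl_d z <= d 1 z].
    Conversely [ds 1 z] exceeds [tl_ds z] by at most a constant plus a
    multiple of the product [(z|z^-1)_1], because once [1], [z], [z ^+ 2] are nearly aligned all the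
    powers of [z] are ([translation_length_ge]).  Hence
    [ds 1 x <= l * d 1 x + c] follows if every [x] can be multiplied by an
    element [f] of a fixed ball so that [(x * f|(x * f)^-1)_1] is bounded.  If
    this fails, every ball of the group almost fixes some [y], in the sense that
    [(y|f * y)_1] is large on the ball.  The Busemann function of such a [y] is
    then a quasimorphism on the ball, and the elements where it is small are
    conjugate into a ball of fixed radius, so that their number is bounded.
    An element [g] with a large value generates a subgroup with boundedly many
    cosets, and the group is virtually cyclic
    ([almost_fixed_virtually_cyclic]).

    To pass from distances to products, take a centre [p] of the triangle with
    vertices [1], [x], [y] in the Cayley graph.  For any metric of the family,
    [(x|y)_1] is within a constant of the distance from [1] to [p]
    ([gromov_product_le]), and the bound on distances applies at [p].

    That [p] serves for all metrics at once, and that [(x|f * x^-1)_1] may be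
    bounded in the word metric instead, is the stability of quasi-geodesics:
    a product that is bounded for the word metric is bounded for every metric
    quasi-isometric to it ([bounded_product_transfer]).  As the metrics need not
    be geodesic, the classical proof is carried out with virtual points, given
    by formulas for their distances to the actual points ([virtual_dist]). *)

(** * The four-point condition and chains of points *)

Section FourPoint.
Variables (R : realType) (X : Type) (d : X -> X -> R) (delta : R).

(** Hyperbolicity without a base point: of the three ways of pairing four
    points, no sum of distances exceeds both others by more than [2 * delta]. *)
Definition four_point : Prop := forall x y z w : X,
  d x y + d z w <= d x z + d y w + 2 * delta \/
  d x y + d z w <= d x w + d y z + 2 * delta.

Lemma gromov_four_point : pseudo_metric d ->
  (forall x y z w,
    Num.min (gromov_product d z x w) (gromov_product d z w y) - delta
      <= gromov_product d z x y) ->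
  four_point.
Proof.
move=> [_ _ dC _] H x y z w; have := H x y z w.
rewrite /gromov_product (dC z w) (dC z y) /Num.min.
rewrite (dC w y) (dC w z).
by case: ifP => _ Hm; [right|left]; rewrite ?(dC z w); have := dC z w; lra.
Qed.

(** The same condition when one of the four points is known only through its
    distances [h] to the others; it need not be a point of the space. *)
Definition four_point_from (h : X -> R) : Prop := forall u v w : X,
  d u v + h w <= d u w + h v + 2 * delta \/
  d u v + h w <= d v w + h u + 2 * delta.

(** Each halving of the chain costs one application of the four-point
    condition, whence an error logarithmic in the number of steps. *)
Lemma chain_far (h : X -> R) (f : nat -> X) (m J : R) (k a b : nat) :
  pseudo_metric d -> 0 <= delta -> four_point_from h -> 0 <= J ->
  (a <= b)%N -> (b - a <= 2 ^ k)%N ->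
  (forall i, (a <= i <= b)%N -> m <= h (f i)) ->
  (forall i, (a <= i < b)%N -> d (f i) (f i.+1) <= J) ->
  2 * m - J - 2 * k%:R * delta <= h (f a) + h (f b) - d (f a) (f b).
Proof.
move=> [_ d0 dC _] delta0 h4 J0.
elim: k a b => [|k IH] a b leab bak mh dJ.
  rewrite mulr0 mul0r subr0.
  have ma : m <= h (f a) by apply: mh; lia.
  have mb : m <= h (f b) by apply: mh; lia.
  have [eb|nb] := eqVneq b a; first by rewrite eb d0; lra.
  have eb : b = a.+1 by lia.
  have dab : d (f a) (f b) <= J by rewrite eb; apply: dJ; lia.
  by lra.
have kd : 2 * k.+1%:R * delta = 2 * k%:R * delta + 2 * delta.
  by rewrite -natr1; lra.
case: (leqP (b - a) (2 ^ k)) => [bak'|bak'].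
  by have := IH a b leab bak' mh dJ; lra.
pose c := (a + 2 ^ k)%N; have e2 : (2 ^ k.+1 = 2 ^ k + 2 ^ k)%N.
  by rewrite expnS mul2n addnn.
have H1 : 2 * m - J - 2 * k%:R * delta <= h (f a) + h (f c) - d (f a) (f c).
  by apply: IH; rewrite /c; [lia|lia| |] => i Hi; [apply: mh|apply: dJ]; lia.
have H2 : 2 * m - J - 2 * k%:R * delta <= h (f c) + h (f b) - d (f c) (f b).
  by apply: IH; rewrite /c; [lia|lia| |] => i Hi; [apply: mh|apply: dJ]; lia.
by have [] := h4 (f a) (f b) (f c); rewrite ?(dC (f b)); lra.
Qed.

(** For a geodesic from [x] to [y], the point at distance [s] from [x] would
    have these distances to the points [w] in a tree.  In a hyperbolic space
    the formula makes sense without any geodesic, and it replaces one. *)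
Definition virtual_dist (x y : X) (s : R) (w : X) : R :=
  Num.max (d w x - s) (d w y - (d x y - s)).

Variables (x y : X) (s : R).
Local Notation h := (virtual_dist x y s).

Lemma virtual_distP w :
  [/\ d w x - s <= h w, d w y - (d x y - s) <= h w &
      h w = d w x - s \/ h w = d w y - (d x y - s)].
Proof.
rewrite /virtual_dist !le_max !lexx orbT; split=> //.
by rewrite /Num.max; case: ifP; [right|left].
Qed.

Lemma virtual_dist_four : four_point -> four_point_from h.
Proof.
move=> d4 u v w; case: (virtual_distP u) (virtual_distP v) => ? ? _ [? ? _].
case: (virtual_distP w) => _ _ [->|->].
  by have [] := d4 u v w x; [left|right]; lra.
by have [] := d4 u v w y; [left|right]; lra.
Qed.

Lemma virtual_dist_lip (s' : R) w : virtual_dist x y s' w <= h w + `|s - s'|.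
Proof.
have [? ? _] := virtual_distP w.
have := ler_norm (s - s'); have := ler_norm (s' - s); rewrite distrC => ? ?.
by rewrite {1}/virtual_dist ge_max; apply/andP; split; lra.
Qed.

Lemma virtual_dist_triangle w w' : four_point -> pseudo_metric d ->
  d w w' <= h w + h w' + 2 * delta.
Proof.
move=> d4 [_ _ dC _]; have [? ? _] := virtual_distP w.
by have [? ? _] := virtual_distP w'; have [] := d4 w w' x y; lra.
Qed.

End FourPoint.

(** * Stability of quasi-geodesics *)

Lemma exp2_dominates (R : realType) (a b : R) :
  exists K : nat, forall k, (K <= k)%N -> a * k%:R + b < (2 ^ k)%:R.
Proof.
have [c ac bc] : exists2 c : nat, a <= c%:R & b <= c%:R.
  exists (Num.bound `|a| + Num.bound `|b|)%N; rewrite natrD.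
    have := archi_boundP (normr_ge0 a); have := ler_norm a.
    by have := ler0n R (Num.bound `|b|); lra.
  have := archi_boundP (normr_ge0 b); have := ler_norm b.
  by have := ler0n R (Num.bound `|a|); lra.
have base : (c * (c + c).+1 < 2 ^ (c + c))%N.
  elim: c {ac bc} => [//|c IH].
  by rewrite addnS addSn !expnS; case: c IH => [//|c] IH; nia.
have Hn j : (c * (c + c + j).+1 < 2 ^ (c + c + j))%N.
  elim: j => [|j IH]; first by rewrite addn0.
  by rewrite addnS expnS; have := ltn_expl (c + c + j) (ltnSn 1); nia.
exists (c + c)%N => k Hk; have := Hn (k - (c + c))%N; rewrite subnKC //.
rewrite -(ltr_nat R) natrM -natr1; have k0 := ler0n R k.
have ak : a * k%:R <= c%:R * k%:R by rewrite ler_wpM2r.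
by lra.
Qed.

Definition quasigeodesic (R : realType) (X : Type) (d : X -> X -> R) (L A : R)
    (n : nat) (f : nat -> X) : Prop :=
  forall i j, (i <= j <= n)%N ->
    (j - i)%:R <= L * (d (f i) (f j) + A) /\ d (f i) (f j) <= L * (j - i)%:R + A.

Section Stability.
Variables (R : realType) (X : Type) (d : X -> X -> R) (delta L A : R).
Hypotheses (dP : pseudo_metric d) (delta0 : 0 <= delta).
Hypotheses (d4 : four_point d delta) (L1 : 1 <= L) (A0 : 0 <= A).

Lemma virtual_dist_start x y s : 0 <= s -> virtual_dist d x y s x = s.
Proof.
case: dP => [_ d0 dC _] s0; have [] := virtual_distP d x y s x.
by rewrite d0 => ? ? []; lra.
Qed.

Lemma virtual_dist_end x y s : s <= d x y ->
  virtual_dist d x y s y = d x y - s.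
Proof.
case: dP => [_ d0 dC _] s0; have [] := virtual_distP d x y s y.
by rewrite d0 (dC y x) => ? ? []; lra.
Qed.

Lemma virtual_dist_ge0 x y s w : 0 <= virtual_dist d x y s w.
Proof.
case: dP => [_ _ dC tri]; have [? ? _] := virtual_distP d x y s w.
by have := tri x w y; rewrite (dC x w); lra.
Qed.

Lemma quasigeodesic_steps n f i j : quasigeodesic d L A n f ->
  (i <= n)%N -> (j <= n)%N ->
  ((i - j) + (j - i))%:R <= L * (d (f i) (f j) + A).
Proof.
move=> fq; wlog ij : i j / (i <= j)%N => [H iN jN|iN jN].
  have [ij|ij] := leqP i j; first exact: H.
  by case: dP => [_ _ dC _]; rewrite addnC dC; apply: H => //; apply: ltnW.
have [] : (j - i)%:R <= L * (d (f i) (f j) + A) /\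
   d (f i) (f j) <= L * (j - i)%:R + A by apply: fq; rewrite ij.
by have -> : (i - j = 0)%N by apply/eqP.
Qed.

Lemma quasigeodesic_chain n f x y s m k i j : quasigeodesic d L A n f ->
  (forall i, (i <= n)%N -> m <= virtual_dist d x y s (f i)) ->
  (i <= n)%N -> (j <= n)%N -> ((i - j) + (j - i) <= 2 ^ k)%N ->
  2 * m - (L + A) - 2 * k%:R * delta <=
    virtual_dist d x y s (f i) + virtual_dist d x y s (f j) - d (f i) (f j).
Proof.
have [? ? ?] : [/\ 0 <= delta, 1 <= L & 0 <= A] by [].
move=> fq mh; wlog ij : i j / (i <= j)%N => [H iN jN ijk|iN jN ijk].
  have [ij|ij] := leqP i j; first exact: H.
  case: (dP) => [_ _ dC _]; rewrite addrC dC [_ (f i) + _]addrC.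
  by have := H j i (ltnW ij) jN iN; rewrite addnC => /(_ ijk); lra.
apply: chain_far => //; [exact: virtual_dist_four|lra|lia| |] => l Hl.
  by apply: mh; lia.
have /fq[_] : (l <= l.+1 <= n)%N by lia.
by rewrite subSnn mulr1.
Qed.

(** If the path from [x] to [y] avoids the ball of radius about [e] around a
    virtual point at which it is (almost) as far from the virtual geodesic as
    it ever gets, then it leaves that ball and returns to it within a number of
    steps linear in [e]; by [chain_far] this forces [e] to be at most
    logarithmic in [e], hence bounded. *)
Lemma virtual_geodesic_near_quasigeodesic : exists2 E : R, 0 <= E &
  forall n f, quasigeodesic d L A n f -> forall s, 0 <= s <= d (f 0) (f n) ->
    exists2 i, (i <= n)%N & virtual_dist d (f 0) (f n) s (f i) <= E.
Proof.
have [? ? ?] : [/\ 0 <= delta, 1 <= L & 0 <= A] by [].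
have [K HK] := exp2_dominates (6 * L * delta)
  (L * (12 + 3 * (L + A) + 20 * delta + A)).
have K0 := ler0n R K.
pose E := 2 + 2^-1 * (L + A) + (K%:R + 2) * delta.
have Kd : 0 <= K%:R * delta by apply: mulr_ge0.
exists E; first by rewrite /E; lra.
move=> n f fq; case: (dP) => [dge d0 dC tri].
set x := f 0; set y := f n; pose h s w := virtual_dist d x y s w.
pose T := [set t | exists2 s : R, 0 <= s <= d x y & forall i, (i <= n)%N -> t <= h s (f i)].
have T0 : T 0.
  by exists 0; rewrite ?lexx ?dge // => i _; apply: virtual_dist_ge0.
(* With [e] slightly above the supremum of [T], the path comes within [e] of
   every virtual point, but it stays at distance at least [e - 2] from one of
   them, at [s]. *)
have hsT : has_sup T.
  split; first by exists 0.
  exists (d x y) => t [s /andP[s0 sD] /(_ 0 isT)].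
  by rewrite /h virtual_dist_start //; lra.
pose e := sup T + 1.
have supT := sup_upper_bound hsT.
have e1 : 1 <= e by have := supT _ T0; rewrite /e; lra.
have near (s : R) : 0 <= s <= d x y -> exists2 i, (i <= n)%N & h s (f i) < e.
  move=> Hs; apply: contrapT => nH.
  have /supT : T e; last by rewrite /e; lra.
  exists s => // i Hi; rewrite leNgt; apply/negP => Hlt; apply: nH.
  by exists i.
suff eE : e <= E.
  by move=> s Hs; have [i iN /ltW hi] := near s Hs; exists i => //; apply: le_trans hi eE.
have [t [s /andP[s0 sD] ts] te] := sup_adherent (ltr01 : 0 < 1 :> R) hsT.
have far i : (i <= n)%N -> e - 2 <= h s (f i).
  by move=> /ts; rewrite /e; lra.
have hx : h s x = s by rewrite /h virtual_dist_start.
have hy : h s y = d x y - s by rewrite /h virtual_dist_end.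
have xn := far 0%N isT; rewrite -/x hx in xn.
have yn := far n (leqnn n); rewrite -/y hy in yn.
(* A point of the path that is close to the virtual point at [s - 2 * e]; seen
   from the one at [s], it lies in the direction of [x].  If [s < 2 * e], then
   [x] itself will do. *)
have [i iN [i1 i2 i3]] : exists2 i, (i <= n)%N & [/\
    2 * (e - 2) <= h s (f i) + h s x - d (f i) x,
    d (f i) x <= s & d (f i) y <= d x y - s + 3 * e].
  case: (ltP s (2 * e)) => s2e.
    by exists 0%N => //; rewrite -/x d0 hx; split; lra.
  have [|i iN hi] := near (s - 2 * e); first by apply/andP; split; lra.
  exists i => //; have [? ? _] := virtual_distP d x y (s - 2 * e) (f i).
  by have := far i iN; rewrite hx; rewrite /h in hi * => ?; split; lra.
have [j jN [j1 j2 j3]] : exists2 j, (j <= n)%N & [/\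
    2 * (e - 2) <= h s (f j) + h s y - d (f j) y,
    d (f j) y <= d x y - s & d (f j) x <= s + 3 * e].
  case: (ltP (d x y - s) (2 * e)) => s2e.
    by exists n => //; rewrite -/y d0 hy (dC y x); split; lra.
  have [|j jN hj] := near (s + 2 * e); first by apply/andP; split; lra.
  exists j => //; have [? ? _] := virtual_distP d x y (s + 2 * e) (f j).
  by have := far j jN; rewrite hy; rewrite /h in hj * => ?; split; lra.
(* The detour from [f i] to [f j] has length linear in [e], but stays far from
   the virtual point at [s], as do the jumps from [x] to [f i] and from [f j] to
   [y]; and [x], [y] are in opposite directions from there. *)
have dij : d (f i) (f j) <= 6 * e + 2 * delta.
  by have [] := d4 (f i) (f j) x y; lra.
have steps := quasigeodesic_steps fq iN jN.
have bound k : ((i - j) + (j - i) <= 2 ^ k)%N ->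
    e <= 2 + 2^-1 * (L + A) + (k%:R + 2) * delta.
  move=> Hk; have cij := quasigeodesic_chain fq far iN jN Hk.
  have h4 := virtual_dist_four x y s d4.
  have kd : 0 <= k%:R * delta by rewrite mulr_ge0.
  rewrite /h in hx hy i1 j1; rewrite (dC _ x) in i1; rewrite (dC (f i)) in cij.
  have [] := h4 x (f j) (f i); have [] := h4 x y (f j);
    by rewrite ?(dC y) ?hx ?hy; lra.
have ex : exists k, ((i - j) + (j - i) <= 2 ^ k)%N.
  by exists ((i - j) + (j - i))%N; apply/ltnW/ltn_expl.
case: (ex_minnP ex) => -[|k] Hk kmin.
  by have := bound _ Hk; rewrite /E; lra.
have eb := bound _ Hk.
have kK : (k < K)%N.
  rewrite ltnNge; apply/negP => /HK; apply/negP; rewrite -leNgt.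
  have : (2 ^ k < (i - j) + (j - i))%N.
    by rewrite ltnNge; apply/negP => /kmin; rewrite ltnn.
  rewrite -(ltr_nat R) => lt2; apply: le_trans (ltW lt2) _.
  apply: le_trans steps _.
  have -> : 6 * L * delta * k%:R + L * (12 + 3 * (L + A) + 20 * delta + A) =
    L * (6 * delta * k%:R + (12 + 3 * (L + A) + 20 * delta + A)) by lra.
  rewrite -(natr1 k) in eb; rewrite ler_pM2l; last by lra.
  by apply: le_trans (_ : 6 * e + 2 * delta + A <= _); lra.
apply: le_trans eb _; rewrite /E lerD2l ler_wpM2r // lerD2r ler_nat.
exact: kK.
Qed.

(** Each virtual point is close to the part of the path before [f t] or to the
    part after it; moving the virtual point from one end to the other, one
    finds a place where it is close to both, and these two points of the path
    enclose [f t] and are close to each other. *)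
Lemma quasigeodesic_near_virtual_geodesic : exists C : R,
  forall n f, quasigeodesic d L A n f -> forall t, (t <= n)%N ->
    gromov_product d (f t) (f 0) (f n) <= C.
Proof.
have [? ? ?] : [/\ 0 <= delta, 1 <= L & 0 <= A] by [].
have [E E0 HE] := virtual_geodesic_near_quasigeodesic.
pose B := L * (2 * E + 1 + 2 * delta + A).
exists (E + L * B + A) => n f fq t tn.
case: (dP) => [dge d0 dC tri].
set x := f 0; set y := f n; pose D := d x y.
(* The virtual point moves from [x] to [y] by steps of length at most 1. *)
pose s (k : nat) := Num.min k%:R D.
have s0 k : 0 <= s k <= D by rewrite /s le_min ler0n dge ge_min lexx orbT.
have sS k : `|s k.+1 - s k| <= 1.
  rewrite /s /Num.min -natr1.
  by case: ltP => H1; case: ltP => H2; rewrite ler_norml; apply/andP; split; lra.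
pose near (P : nat -> Prop) k := exists2 i, (i <= n)%N /\ P i &
  virtual_dist d x y (s k) (f i) <= E.
have [k [k' [[i [iN it] hi] [j [jN tj] hj] kk]]] : exists k k',
    [/\ near (fun i => (i <= t)%N) k, near (fun i => (t <= i)%N) k'
      & `|s k' - s k| <= 1].
  have [N HN] : exists N : nat, D <= N%:R.
    by exists (Num.bound D); apply/ltW/archi_boundP/dge.
  have right : near (fun i => (t <= i)%N) N.
    exists n => //; have -> : s N = D by apply/min_idPr.
    by rewrite virtual_dist_end // subrr.
  have left0 : near (fun i => (i <= t)%N) 0%N.
    exists 0%N => //; have -> : s 0%N = 0 by apply/min_idPl/dge.
    by rewrite virtual_dist_start.
  have [left|nleft] := pselect (forall k, (k <= N)%N -> near (fun i => (i <= t)%N) k).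
    by exists N, N; split; rewrite ?subrr ?normr0 //; apply: left.
  have [k kl kS] : exists2 k, near (fun i => (i <= t)%N) k
      & ~ near (fun i => (i <= t)%N) k.+1.
    apply: contrapT => nH; apply: nleft; elim=> [//|k IH] kN.
    apply: contrapT => nk; apply: nH; exists k => //.
    exact/IH/ltnW.
  exists k, k.+1; split=> //.
  have [i iN hi] := HE n f fq (s k.+1) (s0 _).
  exists i => //; split=> //; rewrite leqNgt; apply/negP => it; apply: kS.
  by exists i => //; split=> //; apply: ltnW.
have hj' := virtual_dist_lip d x y (s k') (s k) (f j).
have dij := virtual_dist_triangle x y (s k) (f i) (f j) d4 dP.
have [ji _] := fq i j (introT andP (conj (leq_trans it tj) jN)).
have jiB : (j - i)%:R <= B.
  apply: le_trans ji _; rewrite /B ler_pM2l; lra.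
have [_ dti] := fq i t (introT andP (conj it tn)).
have tB : L * (t - i)%:R <= L * B.
  rewrite ler_pM2l; last by lra.
  by apply: le_trans jiB; rewrite ler_nat; lia.
have [? ? _] := virtual_distP d x y (s k) (f i).
rewrite /gromov_product (dC x).
have := tri (f t) (f i) x; have := tri (f t) (f i) y; rewrite (dC (f t) (f i)).
by rewrite /D; lra.
Qed.

End Stability.

(** * Gromov products under quasi-isometry *)

(** Integer-valued geodesics, as in the Cayley graph of a group. *)
Definition discretely_geodesic (R : realType) (X : Type) (rho : X -> X -> R) :
    Prop :=
  forall x y, exists n f, [/\ f 0%N = x, f n = y &
    forall i j, (i <= j <= n)%N -> rho (f i) (f j) = (j - i)%:R].

Section Transfer.
Variables (R : realType) (X : Type) (rho : X -> X -> R).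

(** If [(u|v)_p] is bounded for [rho], then two geodesics from [u] to [p] and
    from [p] to [v] form a quasi-geodesic, for [rho] and hence for [d]. *)
Lemma bounded_product_transfer (d : X -> X -> R) (delta L A c : R) :
  pseudo_metric rho -> discretely_geodesic rho ->
  pseudo_metric d -> 0 <= delta -> four_point d delta -> 1 <= L -> 0 <= A ->
  (forall x y, rho x y <= L * (d x y + A)) ->
  (forall x y, d x y <= L * rho x y + A) ->
  0 <= c ->
  exists C, forall p u v,
    gromov_product rho p u v <= c -> gromov_product d p u v <= C.
Proof.
move=> [rge r0 rC rtri] rgeo dP delta0 d4 L1 A0 rd dr c0.
have A'0 : 0 <= A + 2 * c by lra.
have [C HC] := quasigeodesic_near_virtual_geodesic dP delta0 d4 L1 A'0.
exists C => p u v pc.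
have [m [a [a0 am ad]]] := rgeo u p; have [n [b [b0 bn bd]]] := rgeo p v.
pose f i := if (i <= m)%N then a i else b (i - m)%N.
have f0 : f 0%N = u by rewrite /f leq0n.
have fm : f m = p by rewrite /f leqnn.
have fE i : (m <= i)%N -> f i = b (i - m)%N.
  rewrite /f => mi; case: leqP => // im.
  have -> : i = m by lia.
  by rewrite subnn am b0.
have fmn : f (m + n)%N = v by rewrite fE ?leq_addr // addKn.
rewrite -f0 -fm -fmn; apply: HC; last exact: leq_addr.
move=> i j /andP[ij jmn].
(* Each geodesic is followed isometrically; from one to the other, at most
   [2 * c] is lost because [(u|v)_p <= c]. *)
have [lo up] : (j - i)%:R - 2 * c <= rho (f i) (f j) /\
    rho (f i) (f j) <= (j - i)%:R.
  have [jm|mj] := leqP j m.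
    rewrite /f jm (leq_trans ij jm) ad ?ij //; lra.
  have [mi|im] := leqP m i.
    rewrite !fE ?(ltnW mj) // bd; last by lia.
    have -> : (j - m - (i - m) = j - i)%N by lia.
    by lra.
  have fi : f i = a i by rewrite /f (ltnW im).
  have ui : rho u (f i) = i%:R by rewrite fi -a0 ad ?subn0 // (ltnW im).
  have ip : rho (f i) p = (m - i)%:R by rewrite fi -am ad // leqnn (ltnW im).
  have up : rho u p = m%:R by rewrite -a0 -am ad ?subn0 // leqnn.
  have pv : rho p v = n%:R by rewrite -b0 -bn bd ?subn0 // leqnn.
  have pj : rho p (f j) = (j - m)%:R.
    by rewrite fE ?(ltnW mj) // -b0 bd ?subn0 //; lia.
  have jv : rho (f j) v = (n - (j - m))%:R.
    by rewrite fE ?(ltnW mj) // -bn bd //; lia.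
  move: pc; rewrite /gromov_product up pv => pc.
  have := rtri u (f i) v; have := rtri (f i) (f j) v.
  have := rtri (f i) p (f j); rewrite ui ip pj jv.
  rewrite !natrB ?(ltnW im) ?(ltnW mj) //; try lia.
  by move=> ? ? ?; split; lra.
have := rd (f i) (f j); have := dr (f i) (f j) => dr1 rd1; split.
  have : 0 <= (L - 1) * c by apply: mulr_ge0; lra.
  by lra.
have : L * rho (f i) (f j) <= L * (j - i)%:R by rewrite ler_wpM2l //; lra.
by lra.
Qed.

(** Triangles are thin: a point on the geodesic from [o] to [x] at distance
    about [(x|y)_o] from [o] is close to all three sides. *)
Lemma triangle_center (delta : R) :
  pseudo_metric rho -> discretely_geodesic rho -> four_point rho delta ->
  0 <= delta ->
  forall o x y, exists p, [/\ gromov_product rho p o x <= delta + 1,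
    gromov_product rho p o y <= delta + 1 &
    gromov_product rho p x y <= delta + 1].
Proof.
move=> [rge r0 rC rtri] rgeo r4 delta0 o x y.
have [n [f [f0 fn fd]]] := rgeo o x.
have ox : rho o x = n%:R by rewrite -f0 -fn fd ?subn0 // leqnn.
pose a := gromov_product rho o x y.
have a0 : 0 <= a.
  by rewrite /a /gromov_product; have := rtri x o y; lra.
have an : a <= n%:R.
  rewrite /a /gromov_product -ox (rC x o).
  by have := rtri o x y; lra.
have /andP[ma am] := Num.Theory.truncn_itv a0.
set m := Num.truncn a in ma am.
have mn : (m <= n)%N by rewrite -(ler_nat R); apply: le_trans ma an.
(* Here [m] is [(x|y)_o] rounded down. *)
exists (f m).
have om : rho o (f m) = m%:R by rewrite -f0 fd ?subn0.
have mx : rho (f m) x = n%:R - m%:R.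
  by rewrite -fn fd ?leqnn ?mn // natrB.
move: am; rewrite -natr1 => am.
have xy : rho x y = n%:R + rho o y - 2 * a.
  by rewrite /a /gromov_product -ox (rC x o); lra.
have my : rho (f m) y <= rho o y - m%:R + 2 * delta.
  have := r4 (f m) y o x; rewrite (rC (f m) o) (rC y o) (rC y x) om mx xy ox.
  by case; lra.
by rewrite /gromov_product (rC x (f m)) mx om ox xy; split; lra.
Qed.

End Transfer.

(** * Word metrics *)

Section WordMetric.
Variables (R : realType) (G : groupType) (S : set G).
Hypothesis SP : finite_symmetric_generating S.

Local Notation len := (word_length R S).
Local Notation rho := (word_metric R S).

Lemma word_length_le x w : words S x w -> len x <= (size w)%:R.
Proof.
move=> Hw; apply: ge_inf; last by exists w.
by exists 0 => _ [v _ <-]; apply: ler0n.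
Qed.

Lemma word_length_min x : exists2 w, words S x w & len x = (size w)%:R.
Proof.
have [_ _ /(_ x) [w0 Hw0]] := SP.
have ex : exists n, `[< exists2 w, words S x w & size w = n >].
  by exists (size w0); apply/asboolP; exists w0.
case: (ex_minnP ex) => n /asboolP[w Hw wn] nmin; exists w => //.
apply/eqP; rewrite eq_le word_length_le //=; apply: lb_le_inf.
  by exists (size w)%:R, w.
move=> _ [v Hv <-]; rewrite ler_nat wn; apply: nmin.
by apply/asboolP; exists v.
Qed.

Lemma words1 : words S 1%g [::].
Proof. by split=> //; rewrite big_nil. Qed.

Lemma words_cat x y v w : words S x v -> words S y w -> words S (x * y)%g (v ++ w).
Proof.
move=> [Sv <-] [Sw <-]; split; last by rewrite big_cat.
by move=> s; rewrite mem_cat => /orP[/Sv|/Sw].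
Qed.

Lemma words_drop w i : {in w, forall s, S s} ->
  words S (\prod_(s <- drop i w) s)%g (drop i w).
Proof. by move=> Sw; split=> // s /mem_drop /Sw. Qed.

Lemma words_inv x w : words S x w ->
  exists2 v, words S (x^-1)%g v & size v = size w.
Proof.
have [_ Ssym _] := SP.
elim: w x => [|s w IH] x [Sw <-].
  by exists [::] => //; rewrite big_nil invg1; exact: words1.
have [|v Hv vw] := IH (\prod_(t <- w) t)%g.
  by split=> // t tw; apply: Sw; rewrite inE tw orbT.
exists (rcons v (s^-1)%g); last by rewrite size_rcons vw.
rewrite big_cons invgM -cats1; apply: words_cat => //.
split; last by rewrite big_seq1.
by move=> t; rewrite inE => /eqP ->; apply/Ssym/Sw; rewrite mem_head.
Qed.

Lemma word_lengthM x y : len (x * y)%g <= len x + len y.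
Proof.
have [v Hv ->] := word_length_min x; have [w Hw ->] := word_length_min y.
by rewrite -natrD -size_cat; apply: word_length_le; apply: words_cat.
Qed.

Lemma word_length1 : len 1%g = 0.
Proof.
apply/eqP; rewrite eq_le (word_length_le words1).
by have [w _ ->] := word_length_min 1%g; rewrite ler0n.
Qed.

Lemma word_lengthV x : len (x^-1)%g = len x.
Proof.
have le y : len (y^-1)%g <= len y.
  have [w Hw ->] := word_length_min y; have [v Hv <-] := words_inv Hw.
  exact: word_length_le.
by apply/eqP; rewrite eq_le le -{1}(invgK x) le.
Qed.

Lemma word_metric_pseudo : pseudo_metric rho.
Proof.
rewrite /word_metric; split.
- by move=> x y; have [w _ ->] := word_length_min (x^-1 * y)%g; rewrite ler0n.
- by move=> x; rewrite mulVg word_length1.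
- by move=> x y; rewrite -word_lengthV invgM invgK.
- move=> x y z; have := word_lengthM (x^-1 * y)%g (y^-1 * z)%g.
  by rewrite mulgA mulgK.
Qed.

Lemma word_metric_left_invariant : left_invariant rho.
Proof. by move=> g x y; rewrite /word_metric invgM -mulgA mulKg. Qed.

Lemma word_metric1 x : rho 1%g x = len x.
Proof. by rewrite /word_metric invg1 mul1g. Qed.

(** The prefixes of a shortest word spell a geodesic: no part of such a word
    can be shortened. *)
Lemma word_metric_geodesic : discretely_geodesic rho.
Proof.
move=> x y; have [w [Sw wx] lw] := word_length_min (x^-1 * y)%g.
exists (size w), (fun i => x * \prod_(s <- take i w) s)%g; split.
- by rewrite take0 big_nil mulg1.
- by rewrite take_size wx mulVKg.
move=> i j /andP[ij jw]; rewrite word_metric_left_invariant.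
pose f k := (\prod_(s <- take k w) s)%g.
have step k l : (k <= l <= size w)%N -> rho (f k) (f l) <= (l - k)%:R.
  move=> /andP[kl lw']; have -> : f l = (f k * \prod_(s <- drop k (take l w)) s)%g.
    by rewrite /f -big_cat /= -{1}(cat_take_drop k (take l w)) take_takel.
  rewrite /word_metric mulKg; apply: le_trans (word_length_le (words_drop _ _)) _.
    by move=> s /mem_take /Sw.
  by rewrite size_drop size_takel.
have full : rho (f 0%N) (f (size w)) = (size w)%:R.
  by rewrite /f take0 big_nil take_size word_metric1 wx.
have [_ _ _ tri] := word_metric_pseudo.
apply/eqP; rewrite eq_le step ?ij //=.
have := tri (f 0%N) (f i) (f (size w)); have := tri (f i) (f j) (f (size w)).
have := step 0%N i; have := step j (size w); rewrite full leqnn jw (leq_trans ij jw).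
move=> /(_ isT) + /(_ isT); rewrite subn0 !natrB //.
by rewrite -!/(f _); lra.
Qed.

Lemma finite_word_ball n : finite_set [set x | len x <= n%:R].
Proof.
have [Sfin _ _] := SP.
elim: n => [|n IH].
  apply: (sub_finite_set _ (finite_set1 1%g)) => x /=.
  have [[|s w] [_ <-] ->] := word_length_min x; first by rewrite big_nil.
  by rewrite ler_nat.
have fin := finite_image2 (fun s x : G => (s * x)%g) Sfin IH.
apply: (sub_finite_set _ (_ : finite_set ([set 1%g] `|` _))); last first.
  by rewrite finite_setU; split; [exact: finite_set1|exact: fin].
move=> x /=; have [[|s w] [Sw <-] ->] := word_length_min x.
  by rewrite big_nil; left.
rewrite ler_nat /= ltnS => wn; right; exists s; first by apply: Sw; rewrite mem_head.
exists (\prod_(t <- w) t)%g; last by rewrite big_cons.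
apply: le_trans (word_length_le _) (_ : (size w)%:R <= _); last by rewrite ler_nat.
by split=> // t tw; apply: Sw; rewrite inE tw orbT.
Qed.

End WordMetric.

Lemma word_length_bilipschitz (R : realType) (G : groupType) (S S' : set G) :
  finite_symmetric_generating S -> finite_symmetric_generating S' ->
  exists2 M : R, 1 <= M & forall x, word_length R S x <= M * word_length R S' x.
Proof.
move=> SP SP'; have [/finite_seqP[l Sl] _ _] := SP'.
have len0 x : 0 <= word_length R S x.
  by have [w _ ->] := word_length_min R SP x; rewrite ler0n.
pose M := 1 + \sum_(s <- l) word_length R S s.
have M1 : 1 <= M by rewrite lerDl sumr_ge0.
exists M => // x; have [w [Sw <-] ->] := word_length_min R SP' x.
elim: w Sw => [|s w IH] Sw; first by rewrite big_nil word_length1 // mulr0.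
have {}IH := IH (fun t tw => Sw t (@mem_behead _ (s :: w) t tw)).
have sM : word_length R S s <= M.
  have : s \in l by have := Sw s (mem_head _ _); rewrite Sl.
  move=> sl; rewrite /M (big_rem s sl) /=.
  have : 0 <= \sum_(t <- rem s l) word_length R S t by apply: sumr_ge0.
  by lra.
rewrite big_cons /= -natr1; have := word_lengthM R SP s (\prod_(t <- w) t)%g.
by lra.
Qed.

(** * Non-elementary groups have no almost fixed point at infinity *)

Lemma left_coset_cyclic (G : groupType) (g x : G) :
  left_coset (cyclic_subgroup g) (x * g)%g = left_coset (cyclic_subgroup g) x.
Proof.
have HM h : cyclic_subgroup g h -> cyclic_subgroup g (g * h)%g.
  move=> [[|n] [->|->]].
  - by exists 1%N; left; rewrite expg0 mulg1 expg1.
  - by exists 1%N; left; rewrite expg0 invg1 mulg1 expg1.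
  - by exists n.+2; left; rewrite [RHS]expgS.
  - by exists n; right; rewrite expgSr invgM mulVKg.
have HV h : cyclic_subgroup g h -> cyclic_subgroup g (g^-1 * h)%g.
  move=> [[|n] [->|->]].
  - by exists 1%N; right; rewrite expg0 mulg1 expg1.
  - by exists 1%N; right; rewrite expg0 invg1 mulg1 expg1.
  - by exists n; left; rewrite expgS mulKg.
  - by exists n.+2; right; rewrite [in RHS]expgSr invgM.
apply/seteqP; split=> _ [h Hh <-].
  by exists (g * h)%g; [exact: HM|rewrite mulgA].
by exists (g^-1 * h)%g; [exact: HV|rewrite -mulgA mulVKg].
Qed.

Lemma left_coset_cyclicV (G : groupType) (g x : G) :
  left_coset (cyclic_subgroup g) (x * g^-1)%g = left_coset (cyclic_subgroup g) x.
Proof. by rewrite -[in RHS](mulgVK g x) left_coset_cyclic. Qed.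

Lemma infinite_set_seq (T : choiceType) (A : set T) (n : nat) :
  infinite_set A ->
  exists s : seq T, [/\ uniq s, (n <= size s)%N & forall x, x \in s -> A x].
Proof.
move=> /(infinite_set_fset n)[B BA nB]; exists (finmap.enum_fset B).
by split=> //; apply: finmap.fset_uniq.
Qed.

Section AlmostFixed.
Variables (R : realType) (G : groupType) (rho : G -> G -> R) (delta : R).
Hypotheses (rhoP : pseudo_metric rho) (rhoG : left_invariant rho).
Hypotheses (delta0 : 0 <= delta) (rho4 : four_point rho delta).
Hypotheses (rho_geo : discretely_geodesic rho).
Hypothesis rho_fin : forall n : nat, finite_set [set x | rho 1%g x <= n%:R].

(** [y] looks like a point at infinity fixed by the ball of radius [r]. *)
Definition almost_fixed (r : nat) (y : G) : Prop := forall f,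
  rho 1%g f <= r%:R -> 2 * r%:R <= gromov_product rho 1%g y (f * y)%g.

(** The Busemann function of [y]; on elements that fix [y] it measures the
    translation towards [y]. *)
Definition busemann (y h : G) : R := rho 1%g y - rho h y.

Lemma busemann_le y h : `|busemann y h| <= rho 1%g h.
Proof.
case: rhoP => _ _ rC tri; rewrite /busemann ler_norml.
have := tri 1%g h y; have := tri h 1%g y; rewrite (rC h 1%g) => ? ?.
by apply/andP; split; lra.
Qed.

(** The four points [f], [f * g], [y], [f * y]: since [f] almost fixes [y], one of
    the three pairings is much smaller than the other two, which therefore
    nearly agree. *)
Lemma busemann_morph r y f g : almost_fixed r y ->
  rho 1%g f <= r%:R -> rho 1%g (f * g)%g <= r%:R ->
  `|busemann y (f * g)%g - busemann y f - busemann y g| <= 2 * delta.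
Proof.
case: rhoP => rge _ rC tri fix_y fr fgr; have := fix_y f fr.
rewrite /gromov_product /busemann ler_norml (rC y 1%g).
have e1 := rhoG f g y; have e2 := rhoG f 1%g y; rewrite mulg1 in e2.
have := rho4 f y (f * g)%g (f * y)%g; have := rho4 f (f * y)%g (f * g)%g y.
rewrite (rC (f * y)%g (f * g)%g) (rC (f * y)%g y) (rC y (f * g)%g).
have := tri 1%g f y; have := tri 1%g f (f * y)%g; have := tri 1%g (f * g)%g y.
have := tri 1%g (f * g)%g (f * y)%g; have := tri f 1%g (f * g)%g.
rewrite (rC f 1%g) e1 e2.
move=> ? ? ? ? ? h1 h2 ?; apply/andP.
by case: h1; case: h2; split; lra.
Qed.

Lemma busemann1 y : busemann y 1%g = 0.
Proof. by rewrite /busemann subrr. Qed.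

(** An element that almost fixes [y] and translates little towards [y] moves
    little the points on the way to [y], since the geodesics from [1] and from
    [f] to [y] run together from some point on. *)
Lemma busemann_small_displacement r y f K p : almost_fixed r y ->
  rho 1%g f <= r%:R -> `|busemann y f| <= K ->
  rho 1%g p = r%:R -> rho p y = rho 1%g y - r%:R ->
  rho p (f * p)%g <= K + 6 * delta.
Proof.
have ? := delta0; case: rhoP => rge r0 rC tri fix_y fr fK p1 py.
have [rpos rho1] : 0 <= r%:R :> R /\ rho 1%g (f * f^-1)%g <= r%:R.
  by rewrite mulgV r0.
have fV := busemann_morph fix_y fr rho1; rewrite mulgV busemann1 in fV.
move: (fix_y f fr) fV fK; rewrite /gromov_product /busemann !ler_norml (rC y 1%g).
have fy : rho (f^-1)%g y = rho 1%g (f * y)%g by rewrite -(rhoG f) mulgV.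
have ffy : rho f (f * y)%g = rho 1%g y by rewrite -(rhoG f 1%g) mulg1.
have ffp : rho f (f * p)%g = r%:R by rewrite -p1 -(rhoG f 1%g) mulg1.
have fpy : rho (f * p)%g (f * y)%g = rho 1%g y - r%:R by rewrite rhoG.
rewrite fy => prod /andP[m1 m2] /andP[k1 k2].
have H1 : rho (f * p)%g y <= rho f y - r%:R + 2 * delta.
  have := rho4 (f * p)%g y f (f * y)%g; rewrite ffy fpy (rC (f * p)%g f) ffp (rC y f).
  have := tri 1%g f y; have := tri 1%g f (f * y)%g; rewrite ffy.
  by move=> ? ? []; lra.
have H2 : rho 1%g (f * p)%g <= r%:R + K + 4 * delta.
  have := rho4 1%g (f * p)%g f (f * y)%g; rewrite ffy fpy (rC (f * p)%g f) ffp.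
  by case; lra.
have := rho4 p (f * p)%g 1%g y; rewrite (rC p 1%g) p1 py (rC (f * p)%g 1%g).
by case; lra.
Qed.

Lemma bounded_card n : exists N : nat, forall s : seq G, uniq s ->
  (forall x, x \in s -> rho 1%g x <= n%:R) -> (size s <= N)%N.
Proof.
have /finite_seqP[l Hl] := rho_fin n.
exists (size l) => s us Hs; apply: uniq_leq_size => // x /Hs xn.
by have : [set` l] x by rewrite -Hl.
Qed.

(** The conjugates by [p] of the elements with a small Busemann function lie in
    a ball whose radius depends on [K] only, not on [r] or [y]. *)
Lemma busemann_small_card (K : R) : exists N : nat, forall r y s,
  almost_fixed r y -> uniq s ->
  (forall f, f \in s -> rho 1%g f <= r%:R /\ `|busemann y f| <= K) ->
  (size s <= N)%N.
Proof.
case: (rhoP) => rge r0 rC tri.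
have [n Kn] : exists n : nat, K + 6 * delta <= n%:R.
  exists (Num.bound `|K + 6 * delta|).
  by apply: le_trans (ler_norm _) (ltW (archi_boundP _)).
have [N HN] := bounded_card n; exists N => r y s fix_y us Hs.
have [k [a [a0 ak ad]]] := rho_geo 1%g y.
have ky : rho 1%g y = k%:R by rewrite -a0 -ak ad ?subn0 // leqnn.
have rk : (r <= k)%N.
  have := fix_y 1%g; rewrite r0 => /(_ (ler0n _ _)).
  rewrite mul1g /gromov_product r0 (rC y) ky => rk.
  by rewrite -(ler_nat R); have := ler0n R r; lra.
have p1 : rho 1%g (a r) = r%:R by rewrite -a0 ad ?subn0.
have py : rho (a r) y = rho 1%g y - r%:R.
  by rewrite ky -natrB // -ak ad // rk leqnn.
rewrite -(size_map (fun f => (a r)^-1 * (f * a r))%g); apply: HN.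
  by rewrite map_inj_uniq // => f g /mulgI /mulIg.
move=> _ /mapP[f /Hs[fr fK] ->]; apply: le_trans Kn.
rewrite -(rhoG (a r)) mulg1 mulVKg.
exact: (busemann_small_displacement fix_y fr fK).
Qed.

Lemma almost_fixed_le r r' y : (r <= r')%N -> almost_fixed r' y -> almost_fixed r y.
Proof.
move=> rr' fix_y f fr; rewrite -(ler_nat R) in rr'.
have := fix_y f (le_trans fr rr'); lra.
Qed.

(** Multiplying by [g] or its inverse, whichever moves the Busemann function
    towards zero. *)
Lemma busemann_reduce r y g m n h : almost_fixed r y ->
  4 * delta + 2 < `|busemann y g| -> rho 1%g g <= m%:R -> (m <= r)%N ->
  rho 1%g h + (m * n)%:R <= r%:R -> `|busemann y h| <= m%:R + 2 * delta + n%:R ->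
  exists h', [/\ left_coset (cyclic_subgroup g) h' = left_coset (cyclic_subgroup g) h,
    rho 1%g h' <= r%:R & `|busemann y h'| <= m%:R + 2 * delta].
Proof.
have ? := delta0; case: (rhoP) => rge r0 rC tri.
move=> fix_y gbig gm mr; elim: n h => [|n IH] h hr hb.
  by exists h; split=> //; [rewrite muln0 addr0 in hr|rewrite addr0 in hb].
case: (leP `|busemann y h| (m%:R + 2 * delta)) => hsmall.
  exists h; split=> //; apply: le_trans hr.
  by rewrite lerDl ler0n.
have gr : rho 1%g g <= r%:R by apply: le_trans gm _; rewrite ler_nat.
have rho1 : rho 1%g (g * g^-1)%g <= r%:R by rewrite mulgV r0.
have gV := busemann_morph fix_y gr rho1; rewrite mulgV busemann1 in gV.
have gVm : rho 1%g (g^-1)%g <= m%:R.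
  by rewrite -(rhoG g) mulgV mulg1 rC.
have [g' [g'm co g'b]] : exists g', [/\ rho 1%g g' <= m%:R,
    left_coset (cyclic_subgroup g) (h * g')%g = left_coset (cyclic_subgroup g) h &
    (0 < busemann y h /\ busemann y g' < - (2 * delta + 1)) \/
    (busemann y h < 0 /\ 2 * delta + 1 < busemann y g')].
  move: gbig hsmall gV; rewrite ler_norml => gbig hsmall /andP[gV1 gV2].
  case: (ltP (busemann y g) 0) => g0.
    rewrite ltr0_norm // in gbig.
    case: (ltP (busemann y h) 0) => h0.
      by exists (g^-1)%g; rewrite left_coset_cyclicV; split=> //; right; split; lra.
    rewrite ger0_norm // in hsmall; have := ler0n R m.
    by exists g; rewrite left_coset_cyclic; split=> //; left; split; lra.
  rewrite ger0_norm // in gbig.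
  case: (ltP (busemann y h) 0) => h0.
    by exists g; rewrite left_coset_cyclic; split=> //; right; split; lra.
  rewrite ger0_norm // in hsmall; have := ler0n R m.
  by exists (g^-1)%g; rewrite left_coset_cyclicV; split=> //; left; split; lra.
have hg' : rho 1%g (h * g')%g <= rho 1%g h + m%:R.
  apply: le_trans (tri _ h _) _; rewrite lerD2l.
  by rewrite -{1}(mulg1 h) rhoG.
rewrite mulnS natrD in hr; have mn0 := ler0n R (m * n).
have m0 := ler0n R m; have n0 := ler0n R n.
have hgb : `|busemann y (h * g')%g| <= m%:R + 2 * delta + n%:R.
  have bm : `|busemann y (h * g')%g - busemann y h - busemann y g'| <= 2 * delta.
    by apply: busemann_morph fix_y _ _; lra.
  have := busemann_le y g'; move: hb hsmall bm.
  rewrite -natr1 !ler_norml ltr_normr => /andP[? ?] hs /andP[? ?] /andP[? ?].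
  apply/andP; case: g'b => -[? ?]; case/orP: hs => ?; split; lra.
have [|h' [e1 e2 e3]] := IH _ _ hgb; first by lra.
by exists h'; split; rewrite // e1.
Qed.

(** If every ball almost fixes some point then, up to bounded error, the
    Busemann functions of these points are homomorphisms to [R] with kernels of
    bounded size on larger and larger balls, as for a group that is virtually
    infinite cyclic.  An element [g] on which they are not small then generates
    a subgroup of finite index. *)
Lemma almost_fixed_virtually_cyclic :
  (forall r, exists y, almost_fixed r y) -> virtually_cyclic G.
Proof.
move=> Hfix; have ? := delta0.
have [Gfin|Ginf] := pselect (finite_set [set: G]).
  by exists 1%g; apply: finite_image.
have [N HN] := busemann_small_card (4 * delta + 2).
have [E [Euniq sE _]] := infinite_set_seq N.+1 Ginf.
(* More than [N] elements cannot all have small Busemann functions, so that one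
   of them does not, for arbitrarily large [r]. *)
have [g Hg] : exists g, forall r, exists2 y, almost_fixed r y &
    4 * delta + 2 < `|busemann y g|.
  apply: contrapT => nH.
  have Hr g : exists r, forall y, almost_fixed r y -> `|busemann y g| <= 4 * delta + 2.
    apply: contrapT => nr; apply: nH; exists g => r; apply: contrapT => ny.
    apply: nr; exists r => y fix_y; rewrite leNgt; apply/negP => lt.
    by apply: ny; exists y.
  have [rr Hrr] := choice Hr.
  pose R0 := (\sum_(g <- E) (rr g + Num.bound (rho 1%g g)))%N.
  have RE g : g \in E -> (rr g + Num.bound (rho 1%g g) <= R0)%N.
    by move=> gE; rewrite /R0 (big_rem g gE) leq_addr.
  have [y fix_y] := Hfix R0.
  suff : (size E <= N)%N by rewrite leqNgt sE.
  apply: (HN R0 y) => // f fE.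
  have rf := RE f fE; split.
    case: rhoP => rge _ _ _.
    apply/ltW/(lt_le_trans (archi_boundP (rge _ _))).
    by rewrite ler_nat; apply: leq_trans rf; rewrite leq_addl.
  apply: Hrr; apply: almost_fixed_le fix_y; apply: leq_trans rf.
  exact: leq_addr.
exists g; apply: contrapT => Hinf.
case: (rhoP) => rge r0 rC tri.
pose m := Num.bound (rho 1%g g).
have gm : rho 1%g g <= m%:R by apply/ltW/archi_boundP.
have [N' HN'] := busemann_small_card (m%:R + 2 * delta).
have [B [Buniq sB BH]] := infinite_set_seq N'.+1 Hinf.
have [rep Hrep] : exists rep : set G -> G, forall H, H \in B ->
    left_coset (cyclic_subgroup g) (rep H) = H.
  have : forall H : set G, exists x, H \in B ->
      left_coset (cyclic_subgroup g) x = H.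
    move=> H; have [HB|HB] := boolP (H \in B); last by exists 1%g.
    by have [x _ <-] := BH H HB; exists x.
  by move=> /choice[rep Hrep]; exists rep.
pose r0' := (\sum_(H <- B) Num.bound (rho 1%g (rep H)))%N.
have repr H : H \in B -> rho 1%g (rep H) <= r0'%:R.
  move=> HB; apply/ltW/(lt_le_trans (archi_boundP (rge _ _))).
  by rewrite ler_nat /r0' (big_rem H HB) leq_addr.
(* Large enough for [r0'] reduction steps starting in the ball of radius [r0']. *)
pose r := (r0' + m * r0'.+1)%N.
have [y fix_y gbig] := Hg r.
have mr : (m <= r)%N by rewrite /r mulnS; lia.
have [red Hred] : exists red : set G -> G, forall H, H \in B ->
    [/\ left_coset (cyclic_subgroup g) (red H) = H, rho 1%g (red H) <= r%:R
      & `|busemann y (red H)| <= m%:R + 2 * delta].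
  have : forall H : set G, exists x, H \in B ->
    [/\ left_coset (cyclic_subgroup g) x = H, rho 1%g x <= r%:R
      & `|busemann y x| <= m%:R + 2 * delta].
    move=> H; have [HB|HB] := boolP (H \in B); last by exists 1%g.
    have rH := repr H HB; have rb := busemann_le y (rep H).
    have [||x [x1 x2 x3]] := busemann_reduce (n := r0') (h := rep H) fix_y gbig gm mr.
    - by rewrite /r natrD mulnS natrD; have := ler0n R m; lra.
    - by have := ler0n R m; lra.
    by exists x => _; rewrite x1 Hrep.
  by move=> /choice[red Hred]; exists red.
suff : (size (map red B) <= N')%N by rewrite size_map leqNgt sB.
apply: (HN' r y) => //.
  rewrite map_inj_in_uniq // => H H' HB HB' e.
  by have [<- _ _] := Hred H HB; rewrite e; have [-> _ _] := Hred H' HB'.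
by move=> _ /mapP[H HB ->]; have [_ ? ?] := Hred H HB.
Qed.

(** In a group that is not virtually cyclic, one of finitely many translates
    of [x^-1] points away from [x]. *)
Lemma nonelementary_translate : ~ virtually_cyclic G ->
  exists (r : nat) (C : R), forall x, exists2 f, rho 1%g f <= r%:R &
    gromov_product rho 1%g x (f * x^-1)%g <= C.
Proof.
move=> nvc; have ? := delta0; case: (rhoP) => rge r0 rC tri.
apply: contrapT => nH; apply: nvc; apply: almost_fixed_virtually_cyclic => r.
apply: contrapT => nfix; apply: nH; exists r, (2 * r%:R + delta) => x.
apply: contrapT => nf; apply: nfix; exists (x^-1)%g => f fr.
have far g : rho 1%g g <= r%:R ->
    2 * r%:R + delta < gromov_product rho 1%g x (g * x^-1)%g.
  move=> gr; rewrite ltNge; apply/negP => lt; apply: nf; by exists g.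
have := far f fr; have := far 1%g; rewrite r0 => /(_ (ler0n _ _)).
rewrite mul1g /gromov_product (rC (x^-1)%g 1%g).
have := rho4 (x^-1)%g (f * x^-1)%g x 1%g.
rewrite (rC (x^-1)%g 1%g) (rC (f * x^-1)%g 1%g) (rC (f * x^-1)%g x).
by rewrite (rC (x^-1)%g x); case; lra.
Qed.

End AlmostFixed.

(** * Stable translation lengths *)

Lemma archimedean_le (R : realType) (a b c : R) :
  (forall k : nat, k%:R * a <= k%:R * b + c) -> a <= b.
Proof.
move=> H; rewrite leNgt; apply/negP => ba.
have ab : 0 < a - b by lra.
have /= := archi_boundP (normr_ge0 (c / (a - b))).
set k := Num.bound _ => Hk; have := H k; apply/negP; rewrite -ltNge.
have : c / (a - b) < k%:R by apply: le_lt_trans Hk; apply: ler_norm.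
by rewrite ltr_pdivrMr //; lra.
Qed.

(** Fekete's lemma: dividing [n] by [m] bounds [u n / n] by [u m / m] up to a
    remainder that tends to zero. *)
Lemma subadditive_cvg (R : realType) (u : nat -> R) :
  (forall n, 0 <= u n) -> u 0%N = 0 ->
  (forall m n, u (m + n)%N <= u m + u n) ->
  exists l : R, [/\ (fun n : nat => n%:R^-1 * u n) @ \oo --> l,
    forall n, n%:R * l <= u n &
    forall b, (forall n, n%:R * b <= u n) -> b <= l].
Proof.
move=> u0 u00 uD.
have uM q m : u (q * m)%N <= q%:R * u m.
  elim: q => [|q IH]; first by rewrite mul0n u00 mul0r.
  by rewrite mulSn -natr1; have := uD m (q * m)%N; lra.
pose E := [set n.+1%:R^-1 * u n.+1 | n in [set: nat]].
have E0 : lbound E 0 by move=> _ [n _ <-]; rewrite mulr_ge0 ?invr_ge0 ?ler0n.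
have Einf : has_inf E.
  by split; [exists (1%:R^-1 * u 1%N), 0%N | exists 0].
have [_ Elb] := Einf.
have lu n : n%:R * inf E <= u n.
  case: n => [|n]; first by rewrite mul0r.
  rewrite mulrC -ler_pdivlMr ?ltr0n // mulrC.
  by apply: ge_inf => //; exists n.
exists (inf E); split=> //; last first.
  move=> b Hb; apply: lb_le_inf; first by exists (1%:R^-1 * u 1%N), 0%N.
  by move=> _ [n _ <-]; rewrite mulrC ler_pdivlMr ?ltr0n // mulrC.
apply/cvgrPdist_le => eps eps0.
have [|_ [m _ <-] Hm] := inf_adherent _ Einf (eps := eps / 2); first by lra.
rewrite mulrC ltr_pdivrMr ?ltr0n // in Hm.
pose c := m.+1%:R * u 1%N.
exists (Num.bound (c / (eps / 2))).+1 => // n /= nN.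
have n0 : 0 < n%:R :> R by rewrite ltr0n; lia.
have cn : c <= n%:R * (eps / 2).
  rewrite -ler_pdivrMr; last by lra.
  apply/ltW/(lt_le_trans (archi_boundP _)).
    by rewrite divr_ge0 ?mulr_ge0 //; lra.
  by rewrite ler_nat; apply: ltnW.
have un : u n <= n%:R * (inf E + eps).
  pose q := (n %/ m.+1)%N; pose s := (n %% m.+1)%N.
  have Hs : u s <= c.
    have := uM s 1%N; rewrite muln1 => /le_trans; apply.
    by rewrite ler_wpM2r // ler_nat ltnW // ltn_pmod.
  have Hq : q%:R * u m.+1 <= n%:R * (inf E + eps / 2).
    have : 0 <= inf E.
      by apply: lb_le_inf; [exists (1%:R^-1 * u 1%N), 0%N | exact: E0].
    move=> infE0; apply: le_trans (_ : q%:R * ((inf E + eps / 2) * m.+1%:R) <= _).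
      by rewrite ler_wpM2l // ltW.
    rewrite mulrCA mulrC -natrM ler_wpM2r //; first by lra.
    by rewrite ler_nat leq_divM.
  have := uD (q * m.+1)%N s; rewrite -divn_eq.
  by have := uM q m.+1; lra.
rewrite distrC ger0_norm; last by rewrite subr_ge0 mulrC ler_pdivlMr // mulrC.
by rewrite lerBlDl mulrC ler_pdivrMr // mulrC.
Qed.

Lemma left_invariant_dist (R : realType) (G : groupType) (d : G -> G -> R) g h :
  left_invariant d -> d g (g * h)%g = d 1%g h.
Proof. by move=> dG; rewrite -{1}(mulg1 g) dG. Qed.

Section TranslationLength.
Variables (R : realType) (G : groupType) (d : G -> G -> R).
Hypotheses (dP : pseudo_metric d) (dG : left_invariant d).

Local Notation tl := (translation_length d).

(** By subadditivity the limit is an infimum, which avoids limits from here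
    on. *)
Lemma translation_lengthP x : (forall n, n%:R * tl x <= d 1%g (x ^+ n)%g) /\
  forall b, (forall n, n%:R * b <= d 1%g (x ^+ n)%g) -> b <= tl x.
Proof.
case: dP => dge d0 dC tri.
have [||m n|l [ul lu lmax]] := @subadditive_cvg R (fun n => d 1%g (x ^+ n)%g).
- by [].
- by rewrite expg0 d0.
- have := tri 1%g (x ^+ m)%g (x ^+ (m + n))%g.
  by rewrite expgnDr left_invariant_dist.
by rewrite /translation_length (cvg_lim _ ul).
Qed.

Lemma translation_length_ge0 x : 0 <= tl x.
Proof.
have [_] := translation_lengthP x; apply => n; rewrite mulr0.
by case: dP.
Qed.

Lemma translation_length_le x : tl x <= d 1%g x.
Proof. by have [/(_ 1%N)] := translation_lengthP x; rewrite expg1 mul1r. Qed.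

Lemma translation_length_torsion x : torsion x -> tl x = 0.
Proof.
case: dP => _ d0 _ _ [n n0 xn]; apply/eqP.
rewrite eq_le translation_length_ge0 andbT.
have [/(_ n) + _] := translation_lengthP x; rewrite xn d0.
by rewrite pmulr_rle0 ?ltr0n.
Qed.

(** If [1], [x], [x ^+ 2] are roughly aligned then so are all powers of [x],
    so that the distances grow linearly. *)
Lemma translation_length_ge delta x : four_point d delta ->
  d 1%g (x ^+ 2)%g - d 1%g x - 2 * delta <= tl x.
Proof.
move=> d4; case: (dP) => dge d0 dC tri.
set b := _ - 2 * delta; case: (leP b 0) => b0.
  exact: le_trans b0 (translation_length_ge0 x).
pose u n := d 1%g (x ^+ n)%g.
have shift m n : d (x ^+ m)%g (x ^+ (m + n))%g = u n.
  by rewrite expgnDr left_invariant_dist.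
have delta0 : 0 <= delta by have [] := d4 1%g 1%g 1%g 1%g; rewrite d0; lra.
have u00 : u 0%N = 0 by rewrite /u expg0 d0.
have bE : b = u 2%N - u 1%N - 2 * delta by rewrite /u expg1.
have step n : u n + b <= u n.+1.
  elim: n => [|n IH].
    have : u 2%N <= u 1%N + d (x ^+ 1)%g (x ^+ 2)%g by apply: tri.
    by rewrite (shift 1%N 1%N) u00; lra.
  have e1 : d (x ^+ 1)%g (x ^+ n.+2)%g = u n.+1 := shift 1%N n.+1.
  have e2 : d (x ^+ 2)%g (x ^+ n.+2)%g = u n := shift 2%N n.
  have e3 : d (x ^+ 2)%g (x ^+ 1)%g = u 1%N by rewrite dC; apply: (shift 1%N 1%N).
  have := d4 1%g (x ^+ 2)%g (x ^+ 1)%g (x ^+ n.+2)%g; rewrite e1 e2 e3.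
  rewrite -/(u 1%N) -/(u 2%N) -/(u n.+2).
  by case; lra.
have [_] := translation_lengthP x; apply; elim=> [|n IH].
  by rewrite mul0r; apply: dge.
by rewrite -natr1; have := step n; rewrite /u in IH *; lra.
Qed.

End TranslationLength.

(** The additive constant disappears along the powers of [x ^+ n]. *)
Lemma translation_length_compare (R : realType) (G : groupType)
    (d ds : G -> G -> R) (L A : R) :
  pseudo_metric d -> left_invariant d -> pseudo_metric ds -> left_invariant ds ->
  0 <= L -> (forall x y, ds x y <= L * d x y + A) ->
  forall x, translation_length ds x <= L * translation_length d x.
Proof.
move=> dP dG dsP dsG L0 H x.
have [ls _] := translation_lengthP dsP dsG x.
have [_ dmax] := translation_lengthP dP dG x.
have key n : n%:R * translation_length ds x <= L * d 1%g (x ^+ n)%g.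
  apply: (archimedean_le (c := A)) => k.
  rewrite mulrA -natrM; apply: le_trans (ls _) _; apply: le_trans (H _ _) _.
  rewrite lerD2r mulrCA ler_wpM2l // mulnC expgnA.
  have [dge d0 _ tri] := dP.
  elim: k => [|k IH]; first by rewrite expg0 d0 mul0r.
  apply: le_trans (tri _ (x ^+ n ^+ k)%g _) _.
  by rewrite expgSr left_invariant_dist // -(natr1 k); lra.
have [Lpos|L0'] := ltP 0 L.
  rewrite -ler_pdivrMl //; apply: dmax => n.
  by rewrite mulrCA ler_pdivrMl.
have LE : L = 0 by apply/eqP; rewrite eq_le L0' L0.
by have := key 1%N; rewrite LE !mul0r mul1r.
Qed.

(** * Dilations *)

Section Dilation.
Variables (R : realType) (G : groupType) (d ds : G -> G -> R) (L A : R).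
Hypotheses (dP : pseudo_metric d) (dG : left_invariant d).
Hypotheses (dsP : pseudo_metric ds) (dsG : left_invariant ds).
Hypotheses (L0 : 0 <= L) (dsd : forall x y, ds x y <= L * d x y + A).

Lemma Dil_ratio_le x : ~ torsion x ->
  translation_length ds x / translation_length d x <= Dil ds d.
Proof.
move=> tx; apply: ub_le_sup; last by exists x => //; exists x.
exists L => _ [y _ <-]; have ge0 := translation_length_ge0 dP dG y.
rewrite le_eqVlt in ge0; case/orP: ge0 => [/eqP <-|y0]; first by rewrite invr0 mulr0.
by rewrite ler_pdivrMr //; apply: translation_length_compare dsd _.
Qed.

(** When [translation_length d x] vanishes, the ratio says nothing, but then
    [translation_length ds x] vanishes too. *)
Lemma Dil_translation_length x :
  translation_length ds x <= Dil ds d * translation_length d x.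
Proof.
have [tx|tx] := pselect (torsion x).
  by rewrite !translation_length_torsion ?mulr0.
have ge0 := translation_length_ge0 dP dG x.
rewrite le_eqVlt in ge0; case/orP: ge0 => [/eqP x0|x0]; last by rewrite -ler_pdivrMr // Dil_ratio_le.
have := translation_length_compare dP dG dsP dsG L0 dsd x.
by rewrite -x0 !mulr0.
Qed.

Lemma Dil_gt0 x : 0 < translation_length ds x -> 0 < Dil ds d.
Proof.
move=> x0; have tx : ~ torsion x.
  by move=> /(translation_length_torsion dsP dsG) e; move: x0; rewrite e ltxx.
apply: lt_le_trans (Dil_ratio_le tx); rewrite divr_gt0 //.
rewrite lt_neqAle translation_length_ge0 // andbT; apply/eqP => e.
have := translation_length_compare dP dG dsP dsG L0 dsd x.
by rewrite -e mulr0 leNgt x0.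
Qed.

End Dilation.

(** * Comparison of two metrics *)

Section Metrics.
Variables (R : realType) (G : groupType).

Lemma metrics_word_metric (S : set G) (d : G -> G -> R) :
  finite_symmetric_generating S -> metrics d ->
  exists L A : R, [/\ 1 <= L, 0 <= A,
    forall x y, word_metric R S x y <= L * (d x y + A) &
    forall x y, d x y <= L * word_metric R S x y + A].
Proof.
move=> SP [dP _ _ [S' S'P [L [A [L1 A0 H _]]]]].
have [M M1 HM] := word_length_bilipschitz R SP S'P.
have [M' M'1 HM'] := word_length_bilipschitz R S'P SP.
have [rge _ _ _] := word_metric_pseudo R SP.
have [dge _ _ _] := dP.
exists (L * M * M'), (L * A); split.
- by rewrite mulr_ege1 ?mulr_ege1.
- by apply: mulr_ge0 => //; lra.
- move=> x y; have /andP[_ dle] := H x y.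
  apply: le_trans (HM _) _.
  have LA : A <= L * A by rewrite ler_peMl.
  have h1 : word_length R S' (x^-1 * y)%g <= L * (d x y + L * A).
    apply: le_trans dle _; rewrite mulrDr lerD2l.
    apply: le_trans LA _; apply: ler_wpM2l; first lra.
    by rewrite ler_peMl.
  have h2 : 0 <= L * (d x y + L * A).
    by rewrite mulr_ge0 ?addr_ge0 ?mulr_ge0 //; lra.
  apply: le_trans (_ : M * (L * (d x y + L * A)) <= _).
    by rewrite ler_wpM2l //; lra.
  have -> : L * M * M' * (d x y + L * A) = M' * (M * (L * (d x y + L * A))) by lra.
  by rewrite ler_peMl // mulr_ge0 //; lra.
move=> x y; have /andP[dle _] := H x y.
have h1 : d x y <= L * (word_metric R S' x y + A).
  by rewrite -ler_pdivrMl; lra.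
have h2 : L * word_metric R S' x y <= L * (M' * word_metric R S x y).
  by rewrite ler_wpM2l ?HM' //; lra.
have h3 : 0 <= L * (M' * word_metric R S x y).
  by rewrite !mulr_ge0 //; have := rge x y; lra.
have h4 : L * (M' * word_metric R S x y) <= M * (L * (M' * word_metric R S x y)).
  by rewrite ler_peMl.
by lra.
Qed.

Lemma metrics_compare (S : set G) (d ds : G -> G -> R) :
  finite_symmetric_generating S -> metrics d -> metrics ds ->
  exists2 L : R, 0 <= L & exists A, forall x y, ds x y <= L * d x y + A.
Proof.
move=> SP dM dsM.
have [L [A [L1 A0 Hd _]]] := metrics_word_metric SP dM.
have [L' [A' [L'1 A'0 _ Hds]]] := metrics_word_metric SP dsM.
exists (L' * L); first by rewrite mulr_ge0; lra.
exists (L' * L * A + A') => x y; apply: le_trans (Hds x y) _.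
have : L' * word_metric R S x y <= L' * (L * (d x y + A)).
  by rewrite ler_wpM2l //; lra.
by lra.
Qed.

Lemma metrics_four_point (d : G -> G -> R) : metrics d ->
  exists2 delta : R, 0 <= delta & four_point d delta.
Proof.
move=> [dP _ [delta delta0 H] _]; exists delta => //.
exact: gromov_four_point.
Qed.

(** Choosing [f] such that [x * f] and its inverse point in different
    directions, the powers of [x * f] run along a quasi-geodesic. *)
Lemma length_le_translation_length (S : set G) (delta : R) (d : G -> G -> R) :
  finite_symmetric_generating S -> 0 <= delta ->
  four_point (word_metric R S) delta -> ~ virtually_cyclic G -> metrics d ->
  exists (r : nat) (C : R), forall x, exists2 f,
    word_metric R S 1%g f <= r%:R & d 1%g x <= translation_length d (x * f)%g + C.
Proof.
move=> SP delta0 r4 nvc dM.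
have rP := word_metric_pseudo R SP; have rgeo := word_metric_geodesic R SP.
have rG := @word_metric_left_invariant R G S.
have rfin n : finite_set [set x | word_metric R S 1%g x <= n%:R].
  by under eq_set do rewrite word_metric1; apply: finite_word_ball.
have [r [C0 HC0]] := nonelementary_translate rP rG delta0 r4 rgeo rfin nvc.
have [L [A [L1 A0 rd dr]]] := metrics_word_metric SP dM.
have [eps eps0 d4] := metrics_four_point dM.
have [dP dG _ _] := dM.
have [C1 HC1] := bounded_product_transfer rP rgeo dP eps0 d4 L1 A0 rd dr (normr_ge0 C0).
have [dge d0 dC tri] := dP; have [_ _ rC _] := rP.
exists r, (2 * C1 + (L * r%:R + A) + 2 * eps) => x.
have [f fr fC] := HC0 x; exists (f^-1)%g.
  by rewrite -(rG f) mulgV mulg1 rC.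
have := HC1 1%g x (f * x^-1)%g (le_trans fC (ler_norm _)).
set z := (x * f^-1)%g.
have zV : (f * x^-1)%g = (z^-1)%g by rewrite /z invgM invgK.
have z2 : d 1%g (z ^+ 2)%g = d (z^-1)%g z by rewrite -[RHS](dG z) mulgV expg2.
have zz : d (z^-1)%g 1%g = d 1%g z by rewrite -(dG z) mulgV mulg1.
have xz : d x z <= L * r%:R + A.
  rewrite /z left_invariant_dist // -(dG f) mulgV mulg1 dC.
  apply: le_trans (dr _ _) _; rewrite lerD2r ler_wpM2l //; lra.
have := translation_length_ge dP dG z d4.
rewrite zV /gromov_product (dC x 1%g) (dC 1%g (z^-1)%g) zz (dC x (z^-1)%g) z2.
by have := tri (z^-1)%g z x; rewrite (dC z x); lra.
Qed.

(** Both products are within bounded distance of the distances from [1] to a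
    common centre of the triangle with vertices [1], [x] and [y]. *)
Lemma gromov_product_le (S : set G) (delta : R) (d ds : G -> G -> R) (l c : R) :
  finite_symmetric_generating S -> 0 <= delta ->
  four_point (word_metric R S) delta -> metrics d -> metrics ds ->
  0 <= l -> (forall x, ds 1%g x <= l * d 1%g x + c) ->
  exists C, forall x y,
    gromov_product ds 1%g x y <= l * gromov_product d 1%g x y + C.
Proof.
move=> SP delta0 r4 dM dsM l0 H.
have rP := word_metric_pseudo R SP; have rgeo := word_metric_geodesic R SP.
have transfer (e : G -> G -> R) : metrics e -> exists C, forall p u v,
    gromov_product (word_metric R S) p u v <= delta + 1 -> gromov_product e p u v <= C.
  move=> eM; have [L [A [L1 A0 rd dr]]] := metrics_word_metric SP eM.
  have [eps eps0 d4] := metrics_four_point eM; have [eP _ _ _] := eM.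
  by apply: (bounded_product_transfer rP rgeo eP eps0 d4 L1 A0 rd dr); lra.
have [C HC] := transfer _ dM; have [Cs HCs] := transfer _ dsM.
have [[dge d0 dC tri] _ _ _] := dM; have [[sge s0 sC stri] _ _ _] := dsM.
exists (l * (2 * C) + c + Cs) => x y.
have [p [p1 p2 p3]] := triangle_center rP rgeo r4 delta0 1%g x y.
have := HCs _ _ _ p3; have := HC _ _ _ p1; have := HC _ _ _ p2.
have := H p; rewrite /gromov_product.
have := stri 1%g p x; have := stri 1%g p y; have := tri x p y.
rewrite (dC p x) (dC p y) (dC x 1%g) (dC y p) (sC x 1%g) (sC p x) (sC p y) (sC y p).
move=> t1 t2 t3 t4 t5 t6 t7.
have : l * d 1%g p <= l * (2^-1 * (d 1%g x + d 1%g y - d x y) + 2 * C).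
  by rewrite ler_wpM2l //; lra.
by lra.
Qed.

Lemma Dil_metrics_gt0 (d ds : G -> G -> R) :
  non_elementary_hyperbolic R G -> metrics d -> metrics ds -> 0 < Dil ds d.
Proof.
move=> [[S SP [delta delta0 Hr]] nvc] dM dsM.
have rP := word_metric_pseudo R SP.
have r4 := gromov_four_point rP Hr.
have [r [C HC]] := length_le_translation_length SP delta0 r4 nvc dsM.
have [L [A [L1 A0 rd dr]]] := metrics_word_metric SP dsM.
have [M M0 [B HM]] := metrics_compare SP dM dsM.
have [dP dG _ _] := dM; have [dsP dsG _ _] := dsM.
have [x xC] : exists x, C < ds 1%g x.
  apply: contrapT => nH; apply: nvc; exists 1%g; apply: finite_image.
  have fin := finite_word_ball R SP (Num.bound (L * (C + A))).
  apply: (sub_finite_set _ fin) => x _ /=.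
  rewrite -word_metric1; apply: le_trans (rd _ _) _.
  have dC : ds 1%g x <= C by rewrite leNgt; apply/negP => lt; apply: nH; exists x.
  apply: le_trans (_ : L * (C + A) <= _); first by rewrite ler_wpM2l //; lra.
  apply/ltW/archi_boundP/mulr_ge0; first by lra.
  by case: dsP => /(_ 1%g x); lra.
have [f _ fC] := HC x.
by apply: (Dil_gt0 dP dG dsP dsG M0 HM (x := (x * f)%g)); lra.
Qed.

Lemma gromov_product_Dil_le (d ds : G -> G -> R) :
  non_elementary_hyperbolic R G -> metrics d -> metrics ds ->
  exists C, forall x y, gromov_product ds 1%g x y <=
    Dil ds d * gromov_product d 1%g x y + C.
Proof.
move=> HG dM dsM; have lpos := Dil_metrics_gt0 HG dM dsM.
have [[S SP [delta delta0 Hr]] nvc] := HG.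
have rP := word_metric_pseudo R SP.
have r4 := gromov_four_point rP Hr.
have [r [C HC]] := length_le_translation_length SP delta0 r4 nvc dsM.
have [M M0 [B HM]] := metrics_compare SP dM dsM.
have [L [A [L1 A0 rd dr]]] := metrics_word_metric SP dM.
have [dP dG _ _] := dM; have [dsP dsG _ _] := dsM.
pose l := Dil ds d.
apply: (gromov_product_le (c := l * (L * r%:R + A) + C) SP delta0 r4) => //.
  exact: ltW.
move=> x; have [f fr fC] := HC x; apply: le_trans fC _; rewrite addrA lerD2r.
apply: le_trans (Dil_translation_length dP dG dsP dsG M0 HM _) _.
rewrite -/l -mulrDr ler_wpM2l; [by []|exact: ltW|].
apply: le_trans (translation_length_le dP dG _) _.
have [_ _ _ tri] := dP; apply: le_trans (tri _ x _) _.
rewrite lerD2l left_invariant_dist //; apply: le_trans (dr _ _) _.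
by rewrite lerD2r ler_wpM2l //; lra.
Qed.

End Metrics.

Unset Implicit Arguments.

Theorem theorem1p1 (R : realType) (G : groupType)
    (HG : non_elementary_hyperbolic R G) (d ds : G -> G -> R)
    (Hd : metrics d) (Hds : metrics ds) :
  exists2 C : R, 0 <= C &
    forall x y : G,
      (Dil d ds)^-1 * gromov_product d 1%g x y - C
        <= gromov_product ds 1%g x y
        <= Dil ds d * gromov_product d 1%g x y + C.
Proof.
have lpos := Dil_metrics_gt0 HG Hds Hd.
have [C1 H1] := gromov_product_Dil_le HG Hd Hds.
have [C2 H2] := gromov_product_Dil_le HG Hds Hd.
exists (`|C1| + `|(Dil d ds)^-1 * C2|); first by rewrite addr_ge0.
move=> x y; have n1 := ler_norm C1; have n2 := ler_norm ((Dil d ds)^-1 * C2).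
have p1 := normr_ge0 C1; have p2 := normr_ge0 ((Dil d ds)^-1 * C2).
apply/andP; split; last by have := H1 x y; lra.
have : (Dil d ds)^-1 * gromov_product d 1%g x y <=
    gromov_product ds 1%g x y + (Dil d ds)^-1 * C2.
  by rewrite ler_pdivrMl // mulrDr mulVKf ?lt0r_neq0 // H2.
by lra.
Qed.
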